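(* Let $n\ge 4$ be an even integer and let $a,b,c$ be real numbers with $0<\sqrt{3}\,a<b$ and $0<c\le\frac{b^2-3a^2}{2a}$. Then the list of $n$ numbers $$\Lambda_c=\Big\{\tfrac{1}{2a}\big((2n-7)a^2+b^2\big),\,-c,\,\underbrace{-a\pm bi,\ldots,-a\pm bi}_{n-2\text{ complex numbers}}\Big\},$$ in which the conjugate pair $-a+bi,-a-bi$ occurs $\frac{n-2}{2}$ times, is universally realizable.
   Context: Lists are multisets of complex numbers (repetitions allowed). A Jordan canonical form allowed by a list $\Lambda$ of $n$ complex numbers is a Jordan matrix with spectrum $\Lambda$ (with algebraic multiplicity) that is the Jordan canonical form of some real matrix (i.e. the blocks for non-real eigenvalues occur in conjugate pairs of equal sizes). $\Lambda$ is universally realizable if for every Jordan canonical form $\mathbf{J}$ allowed by $\Lambda$ there is an entrywise nonnegative $n\times n$ matrix with Jordan canonical form $\mathbf{J}$ (up to permutation of blocks). *)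

(* Defs.v *)
From HB Require Import structures.
From mathcomp Require Import all_boot all_order all_algebra.
From mathcomp Require Import reals.
From mathcomp Require Import complex.

Set Implicit Arguments.
Unset Strict Implicit.
Unset Printing Implicit Defensive.

Import Order.TTheory GRing.Theory Num.Theory.

Local Open Scope ring_scope.
Local Open Scope complex_scope.

Section JordanForms.
Variable K : fieldType.

Definition jordan_block (z : K) (k : nat) : 'M[K]_k :=
  \matrix_(i, j) (if i == j then z else if j == i.+1 :> nat then 1 else 0).

(* A Jordan matrix is encoded by the sequence of its blocks, a block of
   eigenvalue z and size k being the pair (z, k). *)
Implicit Types bs : seq (K * nat).

Definition block_val bs (i : 'I_(size bs)) : K := (tnth (in_tuple bs) i).1.
Definition block_size bs (i : 'I_(size bs)) : nat := (tnth (in_tuple bs) i).2.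

Definition jordan_mx bs : 'M[K]_(\sum_i @block_size bs i) :=
  \mxdiag_i jordan_block (block_val i) (block_size i).

(* As this is stated up to similarity, the order of the blocks in bs is
   irrelevant. *)
Definition has_jordan_form (n : nat) (A : 'M[K]_n) bs : Prop :=
  all (fun b => 0 < b.2)%N bs /\
  exists e : (\sum_i @block_size bs i)%N = n,
    A ~_{in unitmx} (castmx (e, e) (jordan_mx bs)).

End JordanForms.

Section UniversalRealizability.
Variable R : realType.

(* A list of complex numbers is a sequence of which only the multiset of
   entries matters. *)
Implicit Types L : seq R[i].

Definition complex_mx (n : nat) (M : 'M[R]_n) : 'M[R[i]]_n :=
  map_mx (real_complex R) M.

Definition nonneg_mx (n : nat) (M : 'M[R]_n) : Prop := forall i j, 0 <= M i j.

Definition has_spectrum (n : nat) (A : 'M[R[i]]_n) L : Prop :=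
  char_poly A = \prod_(z <- L) ('X - z%:P).

Definition jordan_form_allowed L (bs : seq (R[i] * nat)) : Prop :=
  has_spectrum (jordan_mx bs) L /\
  exists M : 'M[R]_(size L), has_jordan_form (complex_mx M) bs.

Definition universally_realizable L : Prop :=
  forall bs, jordan_form_allowed L bs ->
  exists M : 'M[R]_(size L), nonneg_mx M /\ has_jordan_form (complex_mx M) bs.

Definition Lambda (n : nat) (a b c : R) : seq R[i] :=
  [:: (((2 * n%:R - 7) * a ^+ 2 + b ^+ 2) / (2 * a))%:C; (- c)%:C]
  ++ flatten (nseq (n - 2)./2 [:: (- a) +i* b; (- a) -i* b]).

End UniversalRealizability.

(* Main.v *)
Require Import Defs.
From mathcomp Require Import all_boot all_order all_algebra.
From mathcomp Require Import reals complex.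
From mathcomp Require Import ring lra zify.

Set Implicit Arguments.
Unset Strict Implicit.
Unset Printing Implicit Defensive.

Import Order.TTheory GRing.Theory Num.Theory.
Local Open Scope ring_scope.

(** Put x = (a^2 + b^2) / (2 a), t = x - 2 a = (b^2 - 3 a^2) / (2 a) and
    m = (n - 2) / 2. The first number of the list is y = t + 2 a m, and
    0 < c <= t, 3 a < 2 x.

    The allowed Jordan forms. The numbers y and - c are simple, hence have one
    block of size 1 each. The ranks of the powers of M - z determine the block
    sizes at z, and for a real M they agree at z and at its conjugate
    ([real_jordan_form_conj]). So an allowed form is given by one list of sizes,
    of sum m, common to - a + b i and - a - b i ([block_list_shape]).

    The realization. The matrix D = [[- 2 a, x], [- 2 a, 0]] has the eigenvalues
    - a + b i and - a - b i, and each of its diagonal entries is the least of its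
    column. Let S be a times the nilpotent Jordan matrix with the given block
    sizes. Adding S to m copies of D gives the block sizes wanted, and a
    conjugation puts the outcome into a form K ([coupled_mx]) whose upper rows still
    sum to x - 2 a = t, whose lower rows have sums at most 0, and in which
    - 2 a and 0 are still the column minima ([chains_coupled],
    [coupled_rowsum], [coupled_ge]). Next, K is bordered by - c:
    C = [[- c, 0], [w, K]], where w is - c on the upper rows of K and 0 on the lower
    ones ([chains_block_lower]). Finally, B = [[0, 0], [- C 1, C]] has zero row sums,
    hence adding a row vector q to all of its rows replaces the eigenvalue 0 by
    the sum of the entries of q and keeps the rest of the Jordan structure
    ([chains_brauer]). The least q that makes B nonnegative in every column is
    (t - c, c, 2 a, ..., 2 a, 0, ..., 0), and its sum is exactly y. *)

(** * Complete systems of Jordan chains *)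

Section Chains.
Variable K : fieldType.
Implicit Types (bs : seq (K * nat)).
Local Notation chain n := {b : K * nat & 'M[K]_(b.2, n)}.

Lemma inj_unitmx n (A : 'M[K]_n) :
  (forall v : 'cV_n, A *m v = 0 -> v = 0) -> A \in unitmx.
Proof.
move=> injA; rewrite -unitmx_tr -row_free_unit -kermx_eq0.
apply/eqP/row_matrixP => k; rewrite row0; apply: trmx_inj; rewrite trmx0.
apply: injA; apply: trmx_inj; rewrite trmx_mul trmxK trmx0.
by apply/sub_kermxP; rewrite row_sub.
Qed.

(** Each block (z, k) of bs contributes a k-row matrix P with P A = J P for the
    Jordan block J, so that the rows of P form a Jordan chain for the left
    action of A. Completeness of the system is expressed dually, by its common
    right kernel being trivial: stacking the P then gives the base change
    matrix, while no row space has to be computed. *)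
Definition jordan_chains n (A : 'M[K]_n) bs :=
  exists ps : seq (chain n),
  [/\ map tag ps = bs,
      {in ps, forall p, tagged p *m A =
                        jordan_block (tag p).1 (tag p).2 *m tagged p}
    & forall v : 'cV_n, {in ps, forall p, tagged p *m v = 0} -> v = 0].

(** The order of the chains is immaterial: stacked in any order they conjugate A
    to the Jordan matrix with the blocks in that order. The size hypothesis
    makes the stack square, so that a trivial kernel means invertibility. *)
Lemma jordan_form_of_chains n (A : 'M[K]_n) bs bs' :
  jordan_chains A bs -> perm_eq bs bs' -> all (fun b => 0 < b.2)%N bs' ->
  (\sum_(b <- bs') b.2)%N = n -> has_jordan_form A bs'.
Proof.
move=> [ps [bsE psA sep]] pbs bs_gt0 sz; split=> //.
have e : (\sum_i @block_size K bs' i)%N = n.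
  by rewrite -sz [RHS]big_tnth.
exists e.
case: ps bsE psA sep => [|p0 ps0]; last set ps := p0 :: ps0.
  move=> /= bsE; move: pbs; rewrite -bsE perm_sym => /perm_nilP bs0 _ sep.
  exists 1%:M; first exact: unitmx1.
  have n0 : n = 0%N by rewrite -sz bs0 big_nil.
  apply/simmxP; first exact: unitmx1.
  by apply/matrixP => -[i lti]; exfalso; move: lti; rewrite n0.
move=> bsE psA sep.
move: pbs; rewrite perm_sym => /(perm_iotaP (tag p0))[s ps_iota bs'E].
have szbs : size bs = size ps by rewrite -bsE size_map.
have szs : size s = size bs' by rewrite bs'E size_map.
have lt_nth_s k : (k < size bs')%N -> (nth 0%N s k < size ps)%N.
  move=> ltk; have : nth 0%N s k \in s by rewrite mem_nth ?szs.
  by rewrite (perm_mem ps_iota) mem_iota szbs.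
have nthE k : (k < size bs')%N ->
    nth (tag p0) bs' k = tag (nth p0 ps (nth 0%N s k)).
  move=> ltk.
  by rewrite bs'E (nth_map 0%N) ?szs // -bsE (nth_map p0) ?lt_nth_s.
(* The tag of the chain and the i-th entry of bs' are equal but not convertible,
   hence the matrix gets its type by destructing the tagged one. *)
have /fin_all_exists[P PE] : forall i : 'I_(size bs'),
    exists X : 'M[K]_(block_size i, _),
    existT (fun b : K * nat => 'M[K]_(b.2, _)) (tnth (in_tuple bs') i) X
      = nth p0 ps (nth 0%N s i).
  move=> i; have tE : tnth (in_tuple bs') i = tag (nth p0 ps (nth 0%N s i)).
    by rewrite (tnth_nth (tag p0)) /= nthE.
  rewrite /block_size; move: tE.
  case: (nth p0 ps _) => b X /= ->; by exists X.
have Psep (v : 'cV_n) : (forall i, P i *m v = 0) -> v = 0.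
  move=> Pv; apply: sep => p pps.
  have lt_ip : (index p ps < size bs)%N by rewrite szbs index_mem.
  have lt_j : (index (index p ps) s < size bs')%N.
    by rewrite -szs index_mem (perm_mem ps_iota) mem_iota.
  have := PE (Ordinal lt_j); have := Pv (Ordinal lt_j).
  rewrite /= nth_index ?(perm_mem ps_iota) ?mem_iota // nth_index //.
  by move=> + <-.
have PA i : P i *m A = jordan_block (block_val i) (block_size i) *m P i.
  have := psA (nth p0 ps (nth 0%N s i)); rewrite -PE /=; apply.
  by rewrite PE mem_nth ?lt_nth_s.
clear - P PA Psep; case: _ / e A P PA Psep => A P PA Psep; rewrite castmx_id.
pose Q := \mxcol_i P i.
have QA : Q *m A = jordan_mx bs' *m Q.
  rewrite mxcol_mul mul_mxdiag_mxcol; apply: eq_mxcol => i.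
  exact: PA.
have Qu : Q \in unitmx.
  apply: inj_unitmx => v; rewrite mxcol_mul => Qv; apply: Psep => i.
  by have /(congr1 (fun X => submxcol X i)) := Qv; rewrite mxcolK submxcol0.
by exists Q => //; apply/simmxP.
Qed.

Lemma jordan_block_sub_unit (z y : K) k : z != y ->
  jordan_block z k - y%:M \in unitmx.
Proof.
move=> zy; rewrite -unitmx_tr unitmxE det_trig.
  by rewrite unitfE prodf_seq_neq0; apply/allP => i _; rewrite !mxE eqxx subr_eq0.
apply/is_trig_mxP => i j ij; rewrite !mxE -!val_eqE /= gtn_eqF // mulr0n subr0.
by rewrite ltn_eqF // ltnS ltnW.
Qed.

(** A vector v with A v = y v is killed by every chain P, because
    (J - y) P v = P (A - y) v = 0 and J - y is invertible. *)
Lemma chains_unit n (A : 'M[K]_n) bs y :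
  jordan_chains A bs -> all (fun b => b.1 != y) bs -> A - y%:M \in unitmx.
Proof.
move=> [ps [bsE psA sep]] bsy; apply: inj_unitmx => v Av.
apply: sep => p pps.
have Ju : jordan_block (tag p).1 (tag p).2 - y%:M \in unitmx.
  apply: jordan_block_sub_unit; move/allP: bsy; apply.
  by rewrite -bsE map_f.
rewrite -[LHS](mulKmx Ju) [X in _ *m X]mulmxA mulmxBl -psA //.
by rewrite -scalar_mxC -mulmxBr -mulmxA Av !mulmx0.
Qed.

Lemma jordan_blockE (z : K) k : jordan_block z k = z%:M + jordan_block 0 k.
Proof.
apply/matrixP => i j; rewrite !mxE.
by case: eqVneq; rewrite ?addr0 ?mulr0n ?add0r.
Qed.

Lemma jordan_block1 (z : K) : jordan_block z 1 = z%:M.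
Proof. by apply/matrixP => i j; rewrite !ord1 !mxE. Qed.

(** * Bordering by a simple eigenvalue *)

(** The rows of P extend to chains (r, P) of the bordered matrix as soon as
    J r = y r + P w, and J - y is invertible. *)
Lemma chains_block_lower n (y : K) (w : 'cV_n) (A : 'M_n) bs :
  jordan_chains A bs -> all (fun b => b.1 != y) bs ->
  jordan_chains (block_mx y%:M 0 w A : 'M_(1 + n)) ((y, 1%N) :: bs).
Proof.
move=> [ps [bsE psA sep]] bsy.
pose J (b : K * nat) : 'M[K]_b.2 := jordan_block b.1 b.2.
pose r (p : chain n) :=
  invmx (J (tag p) - y%:M) *m (tagged p *m w).
pose f p : chain (1 + n) :=
  Tagged _ (row_mx (r p) (tagged p)).
exists (Tagged (fun b : K * nat => 'M[K]_(b.2, 1 + n))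
          (row_mx 1%:M 0 : 'M[K]_((y, 1%N).2, 1 + n))
          :: [seq f p | p <- ps]).
split=> [|q|v sepv].
- by rewrite /= -map_comp -bsE.
- rewrite inE => /predU1P[->|/mapP[p pps ->]] /=.
    rewrite mul_row_block jordan_block1 !mul1mx !mul0mx !addr0 mul_scalar_mx.
    by rewrite scale_row_mx scaler0 scalemx1.
  rewrite mul_row_block mulmx0 add0r mul_mx_row psA //; congr row_mx.
  have Ju : J (tag p) - y%:M \in unitmx.
    apply: jordan_block_sub_unit; move/allP: bsy; apply.
    by rewrite -bsE map_f.
  rewrite -[X in _ + X](mulKVmx Ju) -/(r p) mulmxBl.
  by rewrite scalar_mxC addrC subrK.
- rewrite -[v]vsubmxK in sepv *.
  have := sepv _ (mem_head _ _); rewrite /= mul_row_col mul1mx mul0mx addr0 => u0.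
  suff -> : dsubmx v = 0 by rewrite u0 col_mx0.
  apply: sep => p pps.
  have := sepv (f p); rewrite inE map_f // orbT mul_row_col u0 mulmx0 add0r.
  exact.
Qed.

(** In terms of the all-ones column e of size 1 + n, this is the rank-one
    perturbation B + e (q0, q) of the matrix B = [[0, 0], [- C 1, C]], whose rows
    sum to zero. *)
Definition brauer_mx n (q0 : K) (q : 'rV_n) (C : 'M_n) : 'M[K]_(1 + n) :=
  block_mx q0%:M q
           (const_mx 1 *m q0%:M - C *m const_mx 1) (C + const_mx 1 *m q).

(** Brauer's perturbation theorem with Jordan structure. A chain P of C extends
    to the chain (- P 1, P) of B, which is orthogonal to e and therefore does not
    see the perturbation e (q0, q). The all-ones column e is an eigenvector for
    y = q0 + q 1, and the left eigenvector for y, normalized to pair to 1 with e,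
    has as its tail the solution u of u (C - y) = - q. *)
Lemma chains_brauer n (q0 y : K) (q : 'rV_n) (C : 'M_n) bs :
  jordan_chains C bs -> all (fun b => b.1 != y) bs ->
  q0%:M + q *m const_mx 1 = y%:M ->
  jordan_chains (brauer_mx q0 q C) ((y, 1%N) :: bs).
Proof.
move=> chC; have [ps [bsE psA sep]] := chC => bsy qy.
pose e : 'cV[K]_n := const_mx 1.
have Cu := chains_unit chC bsy.
pose u := - (q *m invmx (C - y%:M)).
have uC : u *m C = y *: u - q.
  have : u *m (C - y%:M) = - q by rewrite mulNmx mulmxKV.
  rewrite mulmxBr => /(canRL (subrK _)) ->.
  by rewrite scalar_mxC mul_scalar_mx addrC.
pose f (p : chain n) : chain (1 + n) :=
  Tagged _ (row_mx (- (tagged p *m e)) (tagged p)).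
exists (Tagged (fun b : K * nat => 'M[K]_(b.2, 1 + n))
          (row_mx (1%:M - u *m e) u : 'M[K]_((y, 1%N).2, 1 + n))
          :: [seq f p | p <- ps]).
split=> [|p|v sepv].
- by rewrite /= -map_comp -bsE.
- rewrite inE => /predU1P[->|/mapP[{}p pps ->]] /=; rewrite mul_row_block mul_mx_row.
    rewrite jordan_block1 mulmxBr mulmxDr !mulmxA uC !mulmxBl !mul1mx.
    rewrite -!/e mul_scalar_mx; congr row_mx.
      rewrite addrA subrK opprB addrA qy scalerBr scalemx1.
      by rewrite -scalemxAl.
    by rewrite addrC -addrA [_ + (q - _)]addrC !subrK -mul_scalar_mx.
  rewrite mulmxBr mulmxDr !mulmxA !mulNmx; congr row_mx.
    by rewrite addrA addNr add0r psA // -mulmxA mulmxN.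
  by rewrite addrCA addNr addr0 psA.
- rewrite -[v]vsubmxK in sepv *; set v0 := usubmx v; set v1 := dsubmx v.
  have v1E : v1 = e *m v0.
    apply/eqP; rewrite -subr_eq0; apply/eqP; apply: sep => p pps.
    have := sepv (f p); rewrite inE map_f // orbT mul_row_col mulmxBr mulNmx.
    by rewrite addrC mulmxA; apply.
  have := sepv _ (mem_head _ _); rewrite /= mul_row_col -/v0 -/v1 v1E.
  rewrite mulmxBl mul1mx mulmxA subrK => ->.
  by rewrite mulmx0 col_mx0.
Qed.

(** * Doubling a nilpotent matrix into a pair of eigenvalues *)

(** Let D = [[- d, x], [- d, 0]], the companion-like matrix of the polynomial
    X ^ 2 + d X + d x. The matrix D * 1 + 1 * S (tensor products) has
    the blocks [[S - d, x], [- d, S]]; this is its conjugate by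
    [[1, 0], [- S / x, 1]]. The conjugation removes S from the upper half, whose
    row sums may not grow, at the price of negative terms in the lower left
    block. *)
Definition coupled_mx m (d x : K) (S : 'M_m) : 'M[K]_(m + m) :=
  block_mx (- d)%:M x%:M (- d%:M - x^-1 *: (d *: S + S *m S)) (S *+ 2).

(** The row (z, x) is a left eigenvector of D for z, so that (z Q, x Q) is a chain
    of D * 1 + 1 * S; the conjugation turns it into R. *)
Lemma coupled_chain m (d x z : K) (S : 'M_m) k (Q : 'M_(k, m)) :
  x != 0 -> z ^+ 2 + d * z + d * x = 0 -> Q *m S = jordan_block 0 k *m Q ->
  let R := row_mx (z *: Q - Q *m S) (x *: Q) in
  R *m coupled_mx d x S = jordan_block z k *m R.
Proof.
move=> x0 zroot QS R; rewrite /R mul_row_block mul_mx_row.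
rewrite [in RHS]jordan_blockE !mulmxDl !mul_scalar_mx; congr row_mx.
  have -> : x *: Q *m (- d%:M - x^-1 *: (d *: S + S *m S)) =
            - (d * x) *: Q - (d *: (Q *m S) + Q *m S *m S).
    rewrite mulmxBr mulmxN mul_mx_scalar scalerA -scaleNr; congr (_ - _).
    rewrite -scalemxAl -scalemxAr scalerA mulfV // scale1r.
    by rewrite mulmxDr -scalemxAr mulmxA.
  rewrite mulmxBr -scalemxAr mulmxA -QS !mul_mx_scalar.
  apply/matrixP => i j; rewrite !mxE.
  (* The two sides differ by - (z ^+ 2 + d z + d x) Q. *)
  apply/eqP; rewrite -subr_eq0 -[X in _ == X](mul0r (- Q i j)) -zroot.
  by apply/eqP; ring.
rewrite !mul_mx_scalar -scalemxAl -[jordan_block 0 k *m _]scalemxAr -QS.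
rewrite mulr2n mulmxDr.
by apply/matrixP => i j; rewrite !mxE; ring.
Qed.

Lemma chains_coupled m (d x z1 z2 : K) (S : 'M_m) ks :
  x != 0 -> z1 != z2 ->
  z1 ^+ 2 + d * z1 + d * x = 0 -> z2 ^+ 2 + d * z2 + d * x = 0 ->
  jordan_chains S [seq (0, k) | k <- ks] ->
  jordan_chains (coupled_mx d x S)
    ([seq (z1, k) | k <- ks] ++ [seq (z2, k) | k <- ks]).
Proof.
move=> x0 z12 z1root z2root [ps [psE psS sep]].
pose f (z : K) (p : chain m) : chain (m + m) :=
  existT _ (z, (tag p).2)
   (row_mx (z *: tagged p - tagged p *m S) (x *: tagged p)).
have tagf z : map tag (map (f z) ps) = [seq (z, k) | k <- ks].
  by have := congr1 (map (fun b => (z, b.2))) psE; rewrite -!map_comp.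
have fS z : z ^+ 2 + d * z + d * x = 0 ->
    {in map (f z) ps, forall p, tagged p *m coupled_mx d x S =
       jordan_block (tag p).1 (tag p).2 *m tagged p}.
  move=> zroot _ /mapP[p pps ->]; apply: coupled_chain => //.
  have : (tag p).1 = 0.
    by have /mapP[k _ ->] : tag p \in [seq (0, k) | k <- ks] by rewrite -psE map_f.
  by move=> <-; exact: psS.
exists (map (f z1) ps ++ map (f z2) ps); split=> [|p|v sepv].
- by rewrite map_cat !tagf.
- by rewrite mem_cat => /orP[]; exact: fS.
- rewrite -[v]vsubmxK in sepv *; set v1 := usubmx v; set v2 := dsubmx v.
  have fv p : p \in ps -> forall z, z \in [:: z1; z2] ->
      z *: (tagged p *m v1) - tagged p *m S *m v1 + x *: (tagged p *m v2) = 0.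
    move=> pps z zz; have := sepv (f z p).
    rewrite mem_cat /= mul_row_col -/v1 -/v2 mulmxBl -!scalemxAl; apply.
    by move: zz; rewrite !inE => /orP[]/eqP->; rewrite map_f ?orbT.
  have v10 : v1 = 0.
    apply: sep => p pps.
    have := etrans (fv p pps z1 (mem_head _ _))
                   (esym (fv p pps z2 (mem_last z1 [:: z2]))).
    move/addIr/addIr/eqP; rewrite -subr_eq0 -scalerBl scaler_eq0 subr_eq0.
    by rewrite (negPf z12) => /eqP.
  have -> : v2 = 0.
    apply: sep => p pps.
    have /eqP := fv p pps z1 (mem_head _ _).
    by rewrite v10 !mulmx0 scaler0 subr0 add0r scaler_eq0 (negPf x0) => /eqP.
  by rewrite v10 col_mx0.
Qed.

(** * Nilpotent matrices with small nonnegative entries *)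

Lemma chains_block_diag n1 n2 (A : 'M[K]_n1) (B : 'M_n2) bs1 bs2 :
  jordan_chains A bs1 -> jordan_chains B bs2 ->
  jordan_chains (block_mx A 0 0 B) (bs1 ++ bs2).
Proof.
move=> [ps [psE psA sepA]] [qs [qsE qsB sepB]].
pose f (p : chain n1) : chain (n1 + n2) :=
  Tagged _ (row_mx (tagged p) 0).
pose g (p : chain n2) : chain (n1 + n2) :=
  Tagged _ (row_mx 0 (tagged p)).
exists (map f ps ++ map g qs); split=> [|p|v sepv].
- by rewrite map_cat -!map_comp -psE -qsE.
- rewrite mem_cat => /orP[]/mapP[{}p pps ->] /=;
    rewrite mul_row_block mul_mx_row !mulmx0 !mul0mx ?addr0 ?add0r.
  + by rewrite psA.
  + by rewrite qsB.
- rewrite -[v]vsubmxK in sepv *; set v1 := usubmx v; set v2 := dsubmx v.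
  have -> : v1 = 0.
    apply: sepA => p pps.
    have := sepv (f p); rewrite mem_cat map_f //= mul_row_col mul0mx addr0.
    exact.
  have -> : v2 = 0.
    apply: sepB => p pps.
    have := sepv (g p); rewrite mem_cat map_f ?orbT //= mul_row_col mul0mx add0r.
    exact.
  by rewrite col_mx0.
Qed.

(** Rescaling the i-th basis vector by a ^ i absorbs the factor a. *)
Lemma chains_scaled_block (a : K) k : a != 0 ->
  jordan_chains (a *: jordan_block 0 k) [:: (0, k)].
Proof.
move=> a0; pose D : 'M[K]_k := diag_mx (\row_i a ^+ i).
have Du : D \in unitmx.
  rewrite unitmxE det_diag unitfE prodf_seq_neq0; apply/allP => i _.
  by rewrite mxE expf_neq0.
exists [:: existT (fun b : K * nat => 'M[K]_(b.2, k)) (0, k) D]; split=> //= [p|v].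
  rewrite inE => /eqP-> /=; rewrite /D mul_diag_mx mul_mx_diag.
  apply/matrixP => i j; rewrite !mxE.
  case: eqP => [_|_]; first by rewrite !(mulr0, mul0r).
  by case: eqP => [->|_]; rewrite ?(mulr0, mul0r) // mulr1 mul1r exprSr.
by move/(_ _ (mem_head _ _)) => /= Dv; rewrite -[v](mulKmx Du) Dv mulmx0.
Qed.

Lemma chains_empty (A : 'M[K]_0) : jordan_chains A [::].
Proof. by exists [::]; split=> // v _; rewrite flatmx0. Qed.

End Chains.

(** The direct sum of the shifts of sizes ks, times a. The condition
    S i j * S j i = 0 is a convenient way to say that both S and S ^ 2 vanish on
    the diagonal: it passes to direct sums without any order on the indices. *)
Lemma nilpotent_chains (R : realFieldType) (K : fieldType)
    (phi : {rmorphism R -> K}) (a : R) (ks : seq nat) : 0 < a ->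
  exists S : 'M[R]_(sumn ks),
  [/\ forall i j, 0 <= S i j, forall i j, S i j * S j i = 0,
      forall i, \sum_j S i j <= a
    & jordan_chains (map_mx phi S) [seq (0, k) | k <- ks]].
Proof.
move=> a0; elim: ks => [|k ks [S [S_ge0 S_tr S_row chS]]] /=.
  by exists 0; split=> [[]|[]|[]|] //; exact: chains_empty.
pose N : 'M[R]_k := a *: jordan_block 0 k.
have NE i j : N i j = if j == i.+1 :> nat then a else 0.
  rewrite !mxE -val_eqE /=; case: eqP => [->|_].
    by rewrite ltn_eqF ?mulr0.
  by case: eqP; rewrite ?mulr1 ?mulr0.
exists (block_mx N 0 0 S); split=> [i j|i j|i|].
- case: (split_ordP i) => {}i ->; case: (split_ordP j) => {}j ->.
  + by rewrite block_mxEul NE; case: ifP => // _; exact: ltW.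
  + by rewrite block_mxEur mxE.
  + by rewrite block_mxEdl mxE.
  + by rewrite block_mxEdr.
- case: (split_ordP i) => {}i ->; case: (split_ordP j) => {}j ->;
    rewrite ?(block_mxEul, block_mxEur, block_mxEdl, block_mxEdr).
  + rewrite !NE; case: eqP => [->|]; rewrite ?mul0r //.
    by rewrite ltn_eqF ?mulr0 // ltnS leqnSn.
  + by rewrite !mxE mul0r.
  + by rewrite !mxE mul0r.
  + exact: S_tr.
- rewrite big_split_ord /=; case: (split_ordP i) => {}i ->.
    rewrite [X in _ + X]big1 ?addr0 => [|j _]; last by rewrite block_mxEur mxE.
    under eq_bigr do rewrite block_mxEul NE.
    rewrite -big_mkcond /=.
    case: (ltnP i.+1 k) => [lti|ltk].
      by rewrite (big_pred1 (Ordinal lti)).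
    rewrite big_pred0 ?ltW // => j; apply/negbTE.
    by rewrite neq_ltn (leq_trans (ltn_ord j)).
  rewrite big1 ?add0r => [|j _]; last by rewrite block_mxEdl mxE.
  by under eq_bigr do rewrite block_mxEdr.
- rewrite map_block_mx !map_mx0 -cat1s; apply: chains_block_diag => //.
  have -> : map_mx phi N = phi a *: jordan_block 0 k.
    apply/matrixP => i j; rewrite [LHS]mxE NE !mxE -val_eqE /=.
    case: eqP => [->|_]; first by rewrite ltn_eqF // mulr1.
    by rewrite if_same mulr0 rmorph0.
  by apply: chains_scaled_block; rewrite fmorph_eq0 gt_eqF.
Qed.

(** * The block list as an invariant *)

Section Uniqueness.
Variable K : fieldType.
Implicit Types (bs : seq (K * nat)).

Lemma char_poly_jordan_mx bs :
  char_poly (jordan_mx bs) =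
  \prod_(y <- flatten [seq nseq b.2 b.1 | b <- bs]) ('X - y%:P).
Proof.
have -> : char_poly (jordan_mx bs) = char_poly (jordan_mx bs)^T.
  by rewrite /char_poly /char_poly_mx -det_tr linearB /= tr_scalar_mx map_trmx.
rewrite char_poly_trig; last first.
  rewrite tr_mxdiag; apply/is_trig_mxblockP; split=> [i j ij|i].
    by rewrite -val_eqE /= ltn_eqF.
  rewrite eqxx conform_mx_id; apply/is_trig_mxP => j l jl; rewrite !mxE.
  by rewrite -val_eqE /= gtn_eqF // ltn_eqF // ltnS ltnW.
transitivity (\prod_(i < size bs) \prod_(j < block_size i) ('X - (block_val i)%:P)).
  rewrite sig_big_dep /= (reindex _ tagnat.sig_bij_on) /=.
  apply: eq_bigr => i _; rewrite !mxE eqxx conform_mx_id mxE eqxx.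
  by [].
rewrite big_flatten /= big_map [RHS]big_tnth.
apply: eq_bigr => i _; rewrite big_const_ord big_nseq.
by [].
Qed.

Lemma jordan_block_exp (y : K) k j :
  (jordan_block y k - y%:M) ^+ j = \matrix_(r, c) (c == (r + j)%N :> nat)%:R.
Proof.
elim: j => [|j IH]; first by apply/matrixP => r c; rewrite !mxE addn0 eq_sym.
rewrite exprS IH; apply/matrixP => r c; rewrite !mxE.
have E s : (jordan_block y k - y%:M) r s = (s == r.+1 :> nat)%:R.
  rewrite !mxE -val_eqE /=; case: eqVneq => [->|_].
    by rewrite subrr ltn_eqF.
  by rewrite mulr0n subr0; case: eqP.
under eq_bigr do rewrite E mxE.
case: (ltnP r.+1 k) => [ltr|ler].
  rewrite (bigD1 (Ordinal ltr)) //= eqxx mul1r big1 ?addr0 ?addSnnS // => s.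
  by rewrite -val_eqE /= => /negPf ->; rewrite mul0r.
rewrite big1 => [|s _]; last first.
  by rewrite (ltn_eqF (leq_trans (ltn_ord s) ler)) mul0r.
rewrite ltn_eqF // (leq_trans (ltn_ord c)) // (leq_trans ler) //.
by rewrite addnS ltnS leq_addr.
Qed.

(** For z = y the nonzero rows of the power are the unit vectors of indices at
    least j, which are also the nonzero rows of copid_mx j. *)
Lemma rank_jordan_block (z y : K) k j :
  \rank ((jordan_block z k - y%:M) ^+ j) = (if z == y then k - j else k)%N.
Proof.
have [->|zy] := eqVneq.
  rewrite jordan_block_exp; case: (leqP j k) => [jk|kj]; last first.
    rewrite (_ : \matrix_(_, _) _ = 0) ?mxrank0 ?(eqP (ltnW kj)) //.
    apply/matrixP => r c; rewrite !mxE ltn_eqF //.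
    by rewrite (leq_trans (ltn_ord c)) // (leq_trans (ltnW kj)) // leq_addl.
  rewrite -(rank_copid_mx K jk); apply/eqmx_rank/andP; split.
    apply/row_subP => r; case: (ltnP (r + j) k) => [lt|le]; last first.
      rewrite (_ : row _ _ = 0) ?sub0mx //; apply/rowP => c; rewrite !mxE ltn_eqF //.
      exact: leq_trans le.
    apply: (eq_row_sub (Ordinal lt)); apply/rowP => c; rewrite !mxE -!val_eqE /=.
    by rewrite [(r + j < j)%N]ltnNge leq_addl andbF subr0 eq_sym.
  apply/row_subP => r; case: (ltnP r j) => [lt|le].
    rewrite (_ : row _ _ = 0) ?sub0mx //; apply/rowP => c; rewrite !mxE lt andbT.
    by rewrite subrr.
  have lt : (r - j < k)%N by rewrite (leq_ltn_trans (leq_subr _ _)).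
  apply: (eq_row_sub (Ordinal lt)); apply/rowP => c; rewrite !mxE /= subnK //.
  by rewrite ltnNge le andbF subr0 -val_eqE eq_sym.
apply: mxrank_unit; have := jordan_block_sub_unit k zy.
by elim: j => [|j IH] u; rewrite ?unitmx1 // exprS unitmx_mul u IH.
Qed.

(** The rank of the j-th power of J - y, for a Jordan matrix J with blocks bs. *)
Definition rank_profile bs (y : K) (j : nat) : nat :=
  \sum_(b <- bs) (if b.1 == y then b.2 - j else b.2).

Lemma rank_jordan_mx bs (y : K) j :
  \rank ((jordan_mx bs - y%:M) ^+ j) = rank_profile bs y j.
Proof.
pose B i := jordan_block (@block_val K bs i) (block_size i) - y%:M.
have -> : (jordan_mx bs - y%:M) ^+ j = \mxdiag_i (B i ^+ j).
  rewrite -mxdiagZ /jordan_mx -mxdiagB.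
  elim: j => [|j IH]; first by rewrite expr0 -[1]/(1%:M) -mxdiagZ.
  rewrite exprS IH -[LHS]/(_ *m _) mul_mxdiag_mxblock; apply: eq_mxblock => i i'.
  by case: eqVneq => [<-|_]; rewrite ?conform_mx_id ?mulmx0 // exprS.
rewrite rank_mxdiag /rank_profile [RHS]big_tnth.
by apply: eq_bigr => i _; rewrite rank_jordan_block.
Qed.

Lemma rank_jordan_form n (A : 'M[K]_n) bs (y : K) j : has_jordan_form A bs ->
  \rank ((A - y%:M) ^+ j) = rank_profile bs y j.
Proof.
move=> [_ [e]]; rewrite -rank_jordan_mx; case: _ / e A => A.
rewrite castmx_id => -[P Pu /(simmxP Pu) PA].
have PAj : P *m (A - y%:M) ^+ j = (jordan_mx bs - y%:M) ^+ j *m P.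
  elim: j => [|j IH]; first by rewrite !expr0 mul1mx mulmx1.
  have PB : P *m (A - y%:M) = (jordan_mx bs - y%:M) *m P.
    by rewrite mulmxBr mulmxBl PA scalar_mxC.
  rewrite !exprS -[X in P *m X]/(_ *m _) mulmxA PB -mulmxA IH.
  by rewrite mulmxA.
rewrite -(mxrankMfree (B := P) ((jordan_mx bs - _) ^+ j)) ?row_free_unit //.
by rewrite -PAj eqmxMfull // row_full_unit.
Qed.

Definition sizes_at (y : K) bs := [seq b.2 | b <- bs & b.1 == y].

Lemma count_sizes_at y k bs : count_mem k (sizes_at y bs) = count_mem (y, k) bs.
Proof.
by rewrite count_map count_filter; apply: eq_count => -[z l] /=; rewrite andbC.
Qed.

Lemma sumn_sizes_at y bs :
  sumn (sizes_at y bs) = count_mem y (flatten [seq nseq b.2 b.1 | b <- bs]).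
Proof.
elim: bs => //= b bs IH; rewrite count_cat count_nseq -IH.
by rewrite /sizes_at /=; case: eqP; rewrite ?mul1n.
Qed.

(** The function j |-> k - j truncated at 0 has a single kink, at j = k; hence the
    second difference of the profile at k counts the blocks of size k. *)
Lemma rank_profile_count bs (y : K) k : (0 < k)%N ->
  (rank_profile bs y k.-1 + rank_profile bs y k.+1 =
   rank_profile bs y k + rank_profile bs y k + count_mem (y, k) bs)%N.
Proof.
move=> k_gt0; rewrite /rank_profile; elim: bs => [|b bs IH]; first by rewrite !big_nil.
rewrite !big_cons /= -pair_eqE /=; move: IH; case: b => z l /=.
by case: (z == y) => /= IH; lia.
Qed.

End Uniqueness.

(** Complex conjugation preserves ranks and sends M - z to M - conjc z when M is
    real; the ranks of the powers of M - z determine the number of blocks. *)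
Lemma real_jordan_form_conj (R : realType) n (M : 'M[R]_n) bs (z : R[i]) k :
  has_jordan_form (complex_mx M) bs -> (0 < k)%N ->
  count_mem (z, k) bs = count_mem (conjc z, k) bs.
Proof.
move=> JM k_gt0.
have conjM : map_mx conjc (complex_mx M - z%:M) = complex_mx M - (conjc z)%:M.
  rewrite map_mxB map_scalar_mx; congr (_ - _).
  by apply/matrixP => i l; rewrite /complex_mx !mxE; exact: conjc_real.
have rk j : rank_profile bs z j = rank_profile bs (conjc z) j.
  rewrite -!(rank_jordan_form _ _ JM).
  rewrite -(mxrank_map (conjc : {rmorphism R[i] -> R[i]})); congr (\rank _).
  elim: j => [|j IH]; first by rewrite !expr0 map_mx1.
  by rewrite [in LHS]exprS [in RHS]exprS map_mxM IH conjM.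
have := rank_profile_count bs z k_gt0.
by rewrite !rk rank_profile_count // => /addnI.
Qed.

(** * Block lists compatible with the spectrum *)

Lemma sumn_pos_eq0 (s : seq nat) : all (ltn 0) s -> sumn s = 0%N -> s = [::].
Proof. by case: s => //= k s /andP[k_gt0 _]; lia. Qed.

Lemma sumn_pos_eq1 (s : seq nat) : all (ltn 0) s -> sumn s = 1%N -> s = [:: 1%N].
Proof.
case: s => //= k s /andP[k_gt0 s_gt0] ks1.
by rewrite (sumn_pos_eq0 s_gt0); last lia; congr [:: _]; lia.
Qed.

Section BlockLists.
Variable K : fieldType.
Implicit Types (bs : seq (K * nat)).

Lemma sizes_at_gt0 (y : K) bs :
  all (fun b => 0 < b.2)%N bs -> all (ltn 0) (sizes_at y bs).
Proof.
move=> bs_gt0; apply/allP => k /mapP[b + ->]; rewrite mem_filter => /andP[_].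
exact: (allP bs_gt0).
Qed.

Lemma count_const_block (y z : K) (k : nat) (ks : seq nat) :
  count_mem (y, k) [seq (z, l) | l <- ks] = ((z == y) * count_mem k ks)%N.
Proof.
rewrite count_map; case: eqVneq => [->|zy].
  by rewrite mul1n; apply: eq_count => l /=; rewrite -pair_eqE /= eqxx.
rewrite mul0n; apply/eqP; rewrite -leqn0 leqNgt -has_count.
by apply/hasPn => l _ /=; rewrite -pair_eqE /= (negPf zy).
Qed.

(** The block sizes at an eigenvalue add up to its multiplicity, which is 1 at y1
    and y2, m at z1 and z2, and 0 elsewhere. *)
Lemma block_list_shape bs (y1 y2 z1 z2 : K) m :
  uniq [:: y1; y2; z1; z2] -> all (fun b => 0 < b.2)%N bs ->
  perm_eq (flatten [seq nseq b.2 b.1 | b <- bs])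
          ([:: y1; y2] ++ flatten (nseq m [:: z1; z2])) ->
  (forall k, (0 < k)%N -> count_mem (z1, k) bs = count_mem (z2, k) bs) ->
  let ks := sizes_at z1 bs in
  perm_eq ((y1, 1%N) :: (y2, 1%N) ::
           [seq (z1, k) | k <- ks] ++ [seq (z2, k) | k <- ks]) bs
  /\ sumn ks = m.
Proof.
move=> uq bs_gt0 /permP pbs cz12 ks.
have [y12 [y1z1 [y1z2 [y2z1 [y2z2 z12]]]]] :
    y1 != y2 /\ y1 != z1 /\ y1 != z2 /\ y2 != z1 /\ y2 != z2 /\ z1 != z2.
  by move: uq; rewrite /= !inE !negb_or -!andbA => /and4P[-> -> -> /and4P[-> -> -> _]].
have cnt y : sumn (sizes_at y bs) =
    ((y1 == y) + ((y2 == y) + m * ((z1 == y) + (z2 == y))))%N.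
  rewrite sumn_sizes_at pbs count_cat /= addn0 -addnA; congr (_ + (_ + _))%N.
  by elim: m {pbs} => //= m ->; rewrite mulSn addnA.
have gt0 y := sizes_at_gt0 y bs_gt0.
split; last first.
  by rewrite cnt (negPf y1z1) (negPf y2z1) eqxx eq_sym (negPf z12) addn0 muln1.
apply/allP => -[y k] _ /=; apply/eqP.
rewrite count_cat !count_const_block -!pair_eqE /= -[RHS]count_sizes_at.
have := cnt y; have := gt0 y.
have [<-|y1y] := eqVneq y1 y.
  rewrite ![_ == y1]eq_sym (negPf y12) (negPf y1z1) (negPf y1z2) muln0.
  by move=> g /(sumn_pos_eq1 g) -> /=; rewrite eq_sym !addn0.
have [<-|y2y] := eqVneq y2 y.
  rewrite ![_ == y2]eq_sym (negPf y2z1) (negPf y2z2) muln0.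
  by move=> g /(sumn_pos_eq1 g) -> /=; rewrite !addn0.
have [<-|z1y] := eqVneq z1 y.
  by rewrite eq_sym (negPf z12) !mul0n !add0n mul1n addn0.
have [<-|z2y] := eqVneq z2 y.
  move=> g _; rewrite !add0n mul1n count_sizes_at.
  case: (posnP k) => [->|k_gt0]; last by rewrite count_sizes_at; exact: cz12.
  have c0 z : count_mem (z, 0%N) bs = 0%N.
    rewrite -count_sizes_at; apply/count_memPn/negP.
    by move/(allP (gt0 z)).
  by rewrite count_sizes_at !c0.
by rewrite muln0 => g /(sumn_pos_eq0 g) ->.
Qed.

End BlockLists.

(** * The nonnegative realization *)

Section Realization.
Variable R : realType.

Lemma brauer_nonneg n (q0 : R) (q : 'rV_n) (C : 'M_n) :
  0 <= q0 -> (forall j, 0 <= q 0 j) ->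
  (forall i, (C *m const_mx 1 : 'cV_n) i 0 <= q0) ->
  (forall i j, 0 <= C i j + q 0 j) ->
  nonneg_mx (brauer_mx q0 q C).
Proof.
move=> q0_ge0 q_ge0 C1 Cq i j; rewrite /brauer_mx.
have e1q p (w : 'rV[R]_p) k l : ((const_mx 1 : 'cV_n) *m w) k l = w 0 l.
  by rewrite mxE big_ord1 mxE mul1r.
case: (split_ordP i) => {}i ->; case: (split_ordP j) => {}j ->;
  rewrite ?(block_mxEul, block_mxEur, block_mxEdl, block_mxEdr).
- by rewrite !ord1 mxE mulr1n.
- by rewrite ord1.
- by rewrite mxE e1q !mxE !ord1 eqxx mulr1n subr_ge0; have := C1 i; rewrite mxE.
- by rewrite mxE e1q.
Qed.

(** On the upper half the sums are exact. On the lower half the contribution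
    - 2 a of the scalar block compensates 2 S, whose row sums are at most 2 a. *)
Lemma coupled_rowsum m (a x : R) (S : 'M_m) :
  0 < x -> 0 < a ->
  (forall i j, 0 <= S i j) -> (forall i, \sum_j S i j <= a) ->
  forall i, (coupled_mx (2 * a) x S *m const_mx 1 : 'cV_(m + m)) i 0 <=
            match split i with inl _ => x - 2 * a | inr _ => 0 end.
Proof.
move=> x0 a0 S_ge0 S_row i; rewrite -col_mx_const mul_block_col.
have s1 k : (S *m const_mx 1 : 'cV_m) k 0 = \sum_j S k j.
  by rewrite mxE; apply: eq_bigr => j _; rewrite mxE mulr1.
rewrite -{1}(splitK i); case: (split i) => k; rewrite ?(col_mxEu, col_mxEd) /=.
  by rewrite !mul_scalar_mx !mxE; lra.
rewrite mulmxBl mulNmx mul_scalar_mx -scalemxAl mulmxDl -scalemxAl -mulmxA.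
rewrite mulr2n mulmxDl; set s := S *m const_mx 1.
have s_ge0 l : 0 <= s l 0 by rewrite s1 sumr_ge0.
have s_le : s k 0 <= a by rewrite s1.
have ss : 0 <= (S *m s) k 0.
  by rewrite mxE; apply: sumr_ge0 => l _; rewrite mulr_ge0.
have s_k : 0 <= s k 0 by [].
move: (S *m s) ss => T T_ge0; move: s s_le s_k {s_ge0} => s s_le s_k.
have : 0 <= x^-1 * (2 * a * s k 0 + T k 0).
  apply: mulr_ge0; first by rewrite invr_ge0 ltW.
  by apply: addr_ge0 => //; rewrite mulr_ge0 // mulr_ge0 // ltW.
by rewrite !mxE; lra.
Qed.

(** In the left columns the smallest entry is - 2 a: the terms subtracted in the
    lower left block lie off the diagonal and do not exceed 2 a, since
    the entries of S and S ^ 2 are at most a and a ^ 2. *)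
Lemma coupled_ge m (a x : R) (S : 'M_m) :
  0 < a -> 3 * a <= 2 * x ->
  (forall i j, 0 <= S i j) -> (forall i j, S i j * S j i = 0) ->
  (forall i, \sum_j S i j <= a) ->
  forall i j, 0 <= coupled_mx (2 * a) x S i j +
    (row_mx (const_mx (2 * a)) 0 : 'rV_(m + m)) 0 j.
Proof.
move=> a0 ax S_ge0 S_tr S_row i j.
have x0 : 0 < x by lra.
have S_le k l : S k l <= a.
  by apply: le_trans (S_row k); rewrite (bigD1 l) //= lerDl sumr_ge0.
have SS_le k l : (S *m S) k l <= a ^+ 2.
  rewrite mxE; apply: (@le_trans _ _ (\sum_j S k j * a)).
    by apply: ler_sum => p _; rewrite ler_wpM2l.
  by rewrite -mulr_suml expr2 ler_wpM2r // ltW.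
have S_diag k : S k k = 0.
  by apply/eqP; rewrite -sqrf_eq0 expr2 S_tr.
have SS_diag k : (S *m S) k k = 0.
  by rewrite mxE big1.
rewrite /coupled_mx; move: (S *m S) SS_le SS_diag => T T_le T_diag.
case: (split_ordP i) => {}i ->; case: (split_ordP j) => {}j ->;
  rewrite ?(block_mxEul, block_mxEur, block_mxEdl, block_mxEdr) ?(row_mxEl, row_mxEr).
- by rewrite !mxE; case: (i == j); rewrite ?mulr1n ?mulr0n; lra.
- by rewrite !mxE addr0; case: (i == j); rewrite ?mulr1n ?mulr0n; lra.
- have [<-|ij] := eqVneq i j.
    by rewrite !mxE S_diag T_diag eqxx mulr1n !mulr0 addr0 mulr0 subr0 addNr.
  rewrite !mxE (negPf ij) mulr0n oppr0 add0r [X in 0 <= X]addrC subr_ge0 ler_pdivrMl //.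
  (* Off the diagonal 2 a S i j + T i j <= 3 a ^+ 2 <= 2 a x. *)
  have Sij := S_le i j; have := T_le i j; have := S_ge0 i j.
  by nra.
- by rewrite mulr2n !mxE addr0 addr_ge0.
Qed.
Local Open Scope complex_scope.

Lemma map_coupled_mx (K : fieldType) (phi : {rmorphism R -> K}) m (d x : R) (S : 'M_m) :
  map_mx phi (coupled_mx d x S) = coupled_mx (phi d) (phi x) (map_mx phi S).
Proof.
rewrite map_block_mx !map_scalar_mx rmorphN map_mxB map_mxN map_scalar_mx.
by rewrite map_mxZ map_mxD map_mxZ map_mxM fmorphV !mulr2n map_mxD.
Qed.

Lemma map_brauer_mx (K : fieldType) (phi : {rmorphism R -> K}) n (q0 : R) q (C : 'M_n) :
  map_mx phi (brauer_mx q0 q C) = brauer_mx (phi q0) (map_mx phi q) (map_mx phi C).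
Proof.
rewrite map_block_mx map_mxB map_mxD !map_mxM map_scalar_mx.
by rewrite !map_const_mx rmorph1.
Qed.

Lemma conj_pair_root (a b : R) (e : R) : 0 < a -> e ^+ 2 = b ^+ 2 ->
  let z : R[i] := (- a) +i* e in
  z ^+ 2 + (2 * a)%:C * z + (2 * a)%:C * ((a ^+ 2 + b ^+ 2) / (2 * a))%:C = 0.
Proof.
move=> a0 eb z.
have -> : (2 * a)%:C * ((a ^+ 2 + b ^+ 2) / (2 * a))%:C = (a ^+ 2 + b ^+ 2)%:C.
  by rewrite -rmorphM /=; congr (_%:C); field; rewrite gt_eqF.
by apply/eqP; rewrite eq_complex /=; apply/andP; split; apply/eqP; rewrite -?eb; ring.
Qed.

(** The vector (q0, q) is minus the vector of the column minima of B, so that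
    B + e (q0, q) is nonnegative. Its entries add up to
    (t - c) + c + 2 a m = y, where t is the upper bound on c: the constant c
    only moves weight between the first two columns. *)
Lemma nonneg_realization (a b c : R) (ks : seq nat) :
  0 < a -> 0 < b -> 3 * a ^+ 2 < b ^+ 2 -> 0 < c ->
  c <= (b ^+ 2 - 3 * a ^+ 2) / (2 * a) ->
  let y := (b ^+ 2 - 3 * a ^+ 2) / (2 * a) + 2 * a * (sumn ks)%:R in
  exists M : 'M[R]_(1 + (1 + (sumn ks + sumn ks))),
    nonneg_mx M /\ jordan_chains (complex_mx M)
      ((y%:C, 1%N) :: ((- c)%:C, 1%N) ::
        [seq ((- a) +i* b, k) | k <- ks] ++ [seq ((- a) -i* b, k) | k <- ks]).
Proof.
move=> a0 b0 ab c0 ct; set t := (_ / _) in ct *; move=> y.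
have [S [S_ge0 S_tr S_row chS]] := nilpotent_chains (real_complex R) ks a0.
pose m := sumn ks; pose x := (a ^+ 2 + b ^+ 2) / (2 * a).
have xt : x = t + 2 * a by rewrite /x /t; field; rewrite gt_eqF.
have t0 : 0 < t by exact: lt_le_trans ct.
have x0 : 0 < x by lra.
have ax : 3 * a <= 2 * x by rewrite xt; lra.
have y0 : 0 < y.
  by apply: ltr_wpDr => //; apply: mulr_ge0 => //; lra.
(* In the upper half of the last rows, the entry - c of w brings the row sum
   x - 2 a = t of the coupled matrix down to q0 = t - c. *)
pose w : 'cV[R]_(m + m) := col_mx (const_mx (- c)) 0.
pose C : 'M[R]_(1 + (m + m)) := block_mx (- c)%:M 0 w (coupled_mx (2 * a) x S).
pose q : 'rV[R]_(1 + (m + m)) := row_mx c%:M (row_mx (const_mx (2 * a)) 0).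
exists (brauer_mx (t - c) q C); split.
  apply: brauer_nonneg => [|j|i|i j].
  - by rewrite subr_ge0.
  - rewrite /q; case: (split_ordP j) => {}j ->; rewrite ?(row_mxEl, row_mxEr).
      by rewrite !ord1 !mxE mulr1n ltW.
    by case: (split_ordP j) => {}j ->; rewrite ?(row_mxEl, row_mxEr) !mxE; lra.
  - rewrite -col_mx_const mul_block_col mul0mx addr0.
    case: (split_ordP i) => {}i ->; rewrite ?(col_mxEu, col_mxEd).
      by rewrite !ord1 mul_scalar_mx !mxE; lra.
    rewrite mxE; have := coupled_rowsum x0 a0 S_ge0 S_row i.
    have -> : (w *m const_mx 1 : 'cV_(m + m)) i 0 = w i 0.
      by rewrite mxE big_ord1 !mxE mulr1.
    move: (coupled_mx _ _ _ *m _) => T; rewrite /w.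
    by case: (split_ordP i) => {}i ->; rewrite ?(col_mxEu, col_mxEd) !mxE; lra.
  - rewrite /C /q; case: (split_ordP j) => {}j ->; case: (split_ordP i) => {}i ->;
      rewrite ?(block_mxEul, block_mxEur, block_mxEdl, block_mxEdr) ?(row_mxEl, row_mxEr).
    + by rewrite !ord1 !mxE eqxx !mulr1n addNr.
    + rewrite !ord1 /w [X in _ + X]mxE eqxx mulr1n.
      by case: (split_ordP i) => {}i ->; rewrite ?(col_mxEu, col_mxEd) !mxE; lra.
    + rewrite mxE add0r.
      by case: (split_ordP j) => {}j ->; rewrite ?(row_mxEl, row_mxEr) !mxE; lra.
    + exact: coupled_ge.
rewrite /complex_mx map_brauer_mx.
have neq_im (u v e : R) : e != 0 -> (u%:C == v +i* e) = false.
  by move=> e0; rewrite eq_complex /= [0 == e]eq_sym (negPf e0) andbF.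
have b_neq0 : b != 0 by rewrite gt_eqF.
have b_neq0' : - b != 0 by rewrite oppr_eq0.
have sz (u : R[i]) (v : R[i]) : v != u -> all (fun p => p.1 != u) [seq (v, k) | k <- ks].
  by move=> vu; apply/allP => _ /mapP[k _ ->].
apply: chains_brauer.
- rewrite /C map_block_mx map_mx0 map_scalar_mx map_coupled_mx.
  apply: chains_block_lower.
    apply: chains_coupled => //.
    + by rewrite fmorph_eq0 gt_eqF.
    + by rewrite eq_complex /= eqxx /=; lra.
    + exact: conj_pair_root.
    + by apply: conj_pair_root => //; rewrite sqrrN.
  by rewrite all_cat !sz // eq_sym neq_im.
- rewrite /= all_cat !sz ?andbT; try by rewrite eq_sym neq_im.
  by rewrite eq_complex /= eqxx andbT; lra.
- apply/matrixP => i j; rewrite !ord1.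
  have -> : y%:C%:M = map_mx (real_complex R) ((t - c)%:M + q *m const_mx 1 : 'M_1).
    rewrite -map_scalar_mx; congr map_mx.
    rewrite -col_mx_const mul_row_col -[X in row_mx _ _ *m X]col_mx_const mul_row_col.
    rewrite mul0mx addr0 mul_scalar_mx; apply/matrixP => k l; rewrite !ord1 !mxE.
    under eq_bigr do rewrite !mxE mulr1.
    by rewrite sumr_const card_ord !mulr1n mulr1 /y -mulr_natr; ring.
  by rewrite map_mxD map_mxM !map_scalar_mx map_const_mx rmorph1.
Qed.

End Realization.

Theorem corollary4p1 (R : realType) (n : nat) (a b c : R)
    (n_ge4 : (4 <= n)%N) (n_even : ~~ odd n)
    (a_gt0 : 0 < Num.sqrt 3 * a) (a_lt_b : Num.sqrt 3 * a < b)
    (c_gt0 : 0 < c) (c_le : c <= (b ^+ 2 - 3 * a ^+ 2) / (2 * a)) :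
  universally_realizable (Lambda n a b c).
Proof.
pose m := (n - 2)./2.
have nE : n = (m.*2 + 2)%N.
  by rewrite /m; move: n_ge4 n_even; clear; lia.
have s3 : 0 < Num.sqrt 3 :> R by rewrite sqrtr_gt0; lra.
have a0 : 0 < a by rewrite -(pmulr_rgt0 _ s3).
have b0 : 0 < b := lt_trans a_gt0 a_lt_b.
have ab : 3 * a ^+ 2 < b ^+ 2.
  have := ltr_pM (ltW a_gt0) (ltW a_gt0) a_lt_b a_lt_b.
  by rewrite -!expr2 exprMn sqr_sqrtr.
have t0 : 0 < (b ^+ 2 - 3 * a ^+ 2) / (2 * a) := lt_le_trans c_gt0 c_le.
pose y := (b ^+ 2 - 3 * a ^+ 2) / (2 * a) + 2 * a * m%:R.
have yE : ((2 * n%:R - 7) * a ^+ 2 + b ^+ 2) / (2 * a) = y.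
  by rewrite /y nE natrD -mul2n natrM; field; rewrite gt_eqF.
have y0 : 0 < y by apply: ltr_wpDr => //; rewrite mulr_ge0 // mulr_ge0 // ltW.
move=> bs [spec [M JM]]; have [bs_gt0 _] := JM.
have perm_bs : perm_eq (flatten [seq nseq b.2 b.1 | b <- bs]) (Lambda n a b c).
  by apply: prod_XsubC_eq; rewrite -spec char_poly_jordan_mx.
have L_uniq : uniq [:: y%:C; (- c)%:C; (- a) +i* b; (- a) -i* b]%C.
  rewrite /= !inE !eq_complex /= !negb_or !negb_and.
  have -> : y != - c by lra.
  have b_neq0 : (0 != b) && (0 != - b) by apply/andP; split; lra.
  move: b_neq0 => /andP[-> ->]; rewrite !orbT /= andbT.
  by apply/orP; right; lra.
have [] := block_list_shape L_uniq bs_gt0 (m := m).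
- by rewrite -yE.
- by move=> k k_gt0; exact: (real_jordan_form_conj _ JM k_gt0).
move: (sizes_at _ _) => ks perm_ks ksm.
have [N [N_ge0 chN]] := nonneg_realization ks a0 b0 ab c_gt0 c_le.
have szL : size (Lambda n a b c) = (1 + (1 + (sumn ks + sumn ks)))%N.
  rewrite ksm size_cat size_flatten /shape map_nseq sumn_nseq -/m.
  by rewrite mul2n -addnn.
have dimE : (\sum_(b <- bs) b.2)%N = (1 + (1 + (sumn ks + sumn ks)))%N.
  rewrite -szL -(perm_size perm_bs) size_flatten.
  rewrite /shape -map_comp sumnE big_map.
  by apply: eq_bigr => p _ /=; rewrite size_nseq.
move: (size _) szL => s ->; exists N; split=> //.
rewrite /y -ksm in perm_ks.
exact: (jordan_form_of_chains chN perm_ks bs_gt0 dimE).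
Qed.
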